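(* Suppose that for every integer $r\ge 2$ and every $r$-uniform hypergraph $H$ with $|V(H)|\le r\chi(H)+r-1$ one has $\chi_l(H)=\chi(H)$. Then for every graph $G$ and every integer $d\ge 0$ with $|V(G)|\le (d+2)\chi^d(G)+(d+1)$, one has $\chi^d_l(G)=\chi^d(G)$.
   Context: Graphs and hypergraphs are finite. A coloring of a hypergraph is proper if no edge is monochromatic; $\chi$ and $\chi_l$ denote chromatic number and list chromatic number (least $k$ such that for every assignment of lists of exactly $k$ colors to the vertices there is a proper coloring choosing each vertex's color from its list). A coloring of a graph $G$ is $d$-improper if each color class induces a subgraph of maximum degree at most $d$; $\chi^d(G)$ is the least number of colors in a $d$-improper coloring, and $\chi^d_l(G)$ is the least $k$ such that for every assignment of lists of exactly $k$ colors there is a $d$-improper coloring choosing each vertex's color from its list. *)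

(* Defs.v *)
From HB Require Import structures.
From mathcomp Require Import all_boot finmap boolp.

Set Implicit Arguments.
Unset Strict Implicit.
Unset Printing Implicit Defensive.

Local Open Scope fset_scope.

(* The value is 0 if no natural number satisfies P; chi_ex, chil_ex, chid_ex
   and chidl_ex below exclude that case for every use in this file's setting. *)
Definition least (P : nat -> Prop) : nat :=
  if pselect (exists k, `[< P k >]) is left exP then ex_minn exP else 0.

Lemma leastP (P : nat -> Prop) : (exists k, P k) ->
  P (least P) /\ forall j, P j -> least P <= j.
Proof.
case=> k Pk; rewrite /least; case: pselect => [exP|[]]; last first.
  by exists k; apply/asboolP.
case: ex_minnP => m /asboolP Pm minm; split=> // j Pj.
by apply: minm; apply/asboolP.
Qed.

Section Coloring.
Variable T : finType.

(* [good] is a condition on colorings, such as being proper. *)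
Variable good : forall C : eqType, (T -> C) -> Prop.

Definition colorable (k : nat) : Prop := exists c : T -> 'I_k, good c.

(* Colors in lists are natural numbers: only finitely many colors occur in the
   lists on a finite vertex set, so any infinite palette gives the same notion. *)
Definition list_colorable (k : nat) : Prop :=
  forall L : T -> {fset nat}, (forall v, #|` L v| = k) ->
    exists2 c : T -> nat, forall v, c v \in L v & good c.

End Coloring.

Section Hypergraph.
Variable T : finType.

(* A hypergraph on T is its set of edges. *)
Definition uniform (r : nat) (E : {set {set T}}) : Prop :=
  forall e, e \in E -> #|e| = r.

Definition monochromatic (C : eqType) (c : T -> C) (e : {set T}) : Prop :=
  forall x y, x \in e -> y \in e -> c x = c y.

Definition proper_coloring (E : {set {set T}}) (C : eqType) (c : T -> C) : Prop :=
  forall e, e \in E -> ~ monochromatic c e.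

Definition chi (E : {set {set T}}) : nat :=
  least (colorable (@proper_coloring E)).

Definition chil (E : {set {set T}}) : nat :=
  least (list_colorable (@proper_coloring E)).

End Hypergraph.

Section Graph.
Variable T : finType.

(* A simple graph on T is a symmetric irreflexive adjacency relation. *)
Definition simple_graph (adj : rel T) : Prop := symmetric adj /\ irreflexive adj.

Definition induced_max_degree (adj : rel T) (A : {set T}) : nat :=
  \max_(v in A) #|[set u in A | adj v u]|.

Definition color_class (C : eqType) (c : T -> C) (i : C) : {set T} :=
  [set v | c v == i].

Definition improper_coloring (adj : rel T) (d : nat)
    (C : eqType) (c : T -> C) : Prop :=
  forall i, induced_max_degree adj (color_class c i) <= d.

Definition chid (d : nat) (adj : rel T) : nat :=
  least (colorable (@improper_coloring adj d)).

Definition chidl (d : nat) (adj : rel T) : nat :=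
  least (list_colorable (@improper_coloring adj d)).

End Graph.

Section Existence.
Variable T : finType.

Lemma list_injective (L : T -> {fset nat}) : (forall v, #|` L v| = #|T|) ->
  exists2 c : T -> nat, forall v, c v \in L v & injective c.
Proof.
move=> sL.
suff /(_ (enum T)) [||c cL cI]: forall s : seq T, uniq s -> size s <= #|T| ->
    exists2 c : T -> nat, {in s, forall v, c v \in L v} & {in s &, injective c}.
- exact: enum_uniq.
- by rewrite cardE.
- exists c => [v|x y]; first by apply: cL; rewrite mem_enum.
  by apply: cI; rewrite mem_enum.
elim=> [|x s IH] /=; first by exists (fun=> 0).
case/andP=> xs us ss; have [c cL cI] := IH us (ltnW ss).
pose A := [fset n | n in map c s]%fset.
have sA : #|` A| <= size s.
  by rewrite -(size_map c); apply: leq_trans (leq_imfset_card _ _ _) _; rewrite ?size_undup.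
have [a aL aA] : exists2 a, a \in L x & a \notin map c s.
  have : L x `\` A != fset0.
    apply/eqP => /eqP; rewrite fsetD_eq0 => /fsubset_leq_card.
    by rewrite sL leqNgt (leq_ltn_trans sA ss).
  by case/fset0Pn=> a; rewrite !inE => /andP[aA aL]; exists a.
have nx v : v \in s -> v == x = false.
  by move=> vs; apply/negP => /eqP vx; rewrite -vx vs in xs.
exists (fun v => if v == x then a else c v) => [v|u v]; rewrite !inE.
  by case: eqP => [->|_] //= /cL.
case: (u =P x) => [->|_] /=; case: (v =P x) => [->|_] //=.
- by move=> _ vs ac; move: aA; rewrite ac map_f.
- by move=> us' _ ac; move: aA; rewrite -ac map_f.
- exact: cI.
Qed.

Variable good : forall C : eqType, (T -> C) -> Prop.
Hypothesis goodI : forall (C : eqType) (c : T -> C), injective c -> good c.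

Lemma colorable_ex : exists k, colorable good k.
Proof. by exists #|T|, enum_rank; apply: goodI; exact: enum_rank_inj. Qed.

Lemma list_colorable_ex : exists k, list_colorable good k.
Proof.
exists #|T| => L /list_injective [c cL cI]; exists c => //; exact: goodI.
Qed.

End Existence.

Lemma proper_injective (T : finType) (E : {set {set T}}) (r : nat)
    (C : eqType) (c : T -> C) :
  1 < r -> uniform r E -> injective c -> proper_coloring E c.
Proof.
move=> r1 uE cI e eE me; move: r1; rewrite -(uE _ eE) => /card_gt1P [x [y [xe ye]]].
by rewrite (cI _ _ (me _ _ xe ye)) eqxx.
Qed.

Lemma improper_injective (T : finType) (adj : rel T) (d : nat)
    (C : eqType) (c : T -> C) :
  simple_graph adj -> injective c -> improper_coloring adj d c.
Proof.
move=> [_ irr] cI i; apply/bigmax_leqP => v; rewrite inE => /eqP cv.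
rewrite (_ : [set _ in _ | _] = set0) ?cards0 //; apply/setP => u; rewrite !inE.
by apply/negP => /andP[/eqP cu]; rewrite (cI u v) ?irr // cu cv.
Qed.

Lemma chi_ex (T : finType) (E : {set {set T}}) (r : nat) :
  1 < r -> uniform r E -> exists k, colorable (@proper_coloring T E) k.
Proof. by move=> r1 uE; apply: colorable_ex => C c; apply: proper_injective uE. Qed.

Lemma chil_ex (T : finType) (E : {set {set T}}) (r : nat) :
  1 < r -> uniform r E -> exists k, list_colorable (@proper_coloring T E) k.
Proof. by move=> r1 uE; apply: list_colorable_ex => C c; apply: proper_injective uE. Qed.

Lemma chid_ex (T : finType) (adj : rel T) (d : nat) :
  simple_graph adj -> exists k, colorable (@improper_coloring T adj d) k.
Proof. by move=> sg; apply: colorable_ex => C c; apply: improper_injective. Qed.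

Lemma chidl_ex (T : finType) (adj : rel T) (d : nat) :
  simple_graph adj -> exists k, list_colorable (@improper_coloring T adj d) k.
Proof. by move=> sg; apply: list_colorable_ex => C c; apply: improper_injective. Qed.

(* Main.v *)
Require Import Defs.
From mathcomp Require Import all_boot.
From mathcomp Require Import boolp.

(** A coloring is [d]-improper exactly when no star K_{1,d+1} of the graph is
    monochromatic, so the d-improper colorings of a graph are the proper
    colorings of the (d+2)-uniform hypergraph of its (d+1)-stars, and the
    hypothesis applies to that hypergraph with r = d + 2. *)

(** [n] counts the leaves. Stars need not be induced, and those on the same vertices with different
    centres give one edge. *)
Definition star_hypergraph (T : finType) (adj : rel T) (n : nat) : {set {set T}} :=
  [set e : {set T} | (#|e| == n.+1) &&
     [exists v in e, e :\ v \subset [set u | adj v u]]].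

Lemma star_hypergraph_uniform (T : finType) (adj : rel T) (n : nat) :
  uniform n.+1 (star_hypergraph T adj n).
Proof. by move=> e; rewrite inE => /andP[/eqP]. Qed.

Lemma proper_star_hypergraphE (T : finType) (adj : rel T) (d : nat)
    (C : eqType) (c : T -> C) : irreflexive adj ->
  proper_coloring (star_hypergraph T adj d.+1) c <-> improper_coloring adj d c.
Proof.
move=> irr; split=> [prop i|impr e].
  apply/bigmax_leqP => v; rewrite inE => /eqP cv.
  (* If [v] has too many neighbours in its class, pick exactly [d.+1] of them as the leaves [s];
     irreflexivity keeps [v] out of [s], so the star has [d.+2] vertices. *)
  rewrite leqNgt; apply/negP => /card_geqP[s [us ss sN]].
  have NsP u : u \in s -> c u = i /\ adj v u.
    by move=> /sN; rewrite !inE => /andP[/eqP].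
  have vs : v \notin [set u in s].
    by rewrite inE; apply/negP => /NsP[_]; rewrite irr.
  apply: (prop (v |: [set u in s])).
    rewrite inE cardsU1 vs cardsE (card_uniqP us) ss eqxx /=.
    apply/existsP; exists v; rewrite setU11 /=.
    by apply/subsetP => u; rewrite !inE; case: eqP => //= _ /NsP[].
  have ci u : u \in v |: [set u in s] -> c u = i.
    by rewrite !inE => /orP[/eqP->|/NsP[]].
  by move=> x y /ci-> /ci->.
rewrite inE => /andP[/eqP se /exists_inP[v ve sub]] mono.
(* The centre [v] of a monochromatic star has all [d.+1] leaves as neighbours in its own class. *)
have := impr (c v); apply/negP; rewrite -ltnNge.
apply: (@leq_trans #|[set u in color_class c (c v) | adj v u]|); last first.
  by apply: (leq_bigmax_cond (F := fun w => #|[set u in _ | adj w u]|)); rewrite inE.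
have <- : #|e :\ v| = d.+1 by apply/eqP; rewrite -eqSS -se (cardsD1 v e) ve.
apply/subset_leq_card/subsetP => u uev; move: (subsetP sub _ uev).
rewrite !inE => ->; rewrite andbT; apply/eqP/mono => //.
by move: uev; rewrite !inE => /andP[].
Qed.

(** Equality over all color types lets one rewrite treat both [chi] (colors in ['I_k]) and [chil]
    (colors in [nat]). *)
Lemma proper_star_hypergraph (T : finType) (adj : rel T) (d : nat) :
  irreflexive adj ->
  @proper_coloring T (star_hypergraph T adj d.+1) = @improper_coloring T adj d.
Proof.
move=> irr; apply: functional_extensionality_dep => C; apply/funext => c.
exact/propext/proper_star_hypergraphE.
Qed.

Theorem theorem2p3
    (hyp : forall (r : nat) (T : finType) (E : {set {set T}}),
       2 <= r -> uniform r E ->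
       #|T| <= r * chi E + (r - 1) -> chil E = chi E)
    (T : finType) (adj : rel T) (d : nat)
    (hG : simple_graph adj)
    (hcard : #|T| <= (d + 2) * chid d adj + (d + 1)) :
  chidl d adj = chid d adj.
Proof.
have [_ irr] := hG.
have := hyp d.+2 T (star_hypergraph T adj d.+1) isT
  (star_hypergraph_uniform T adj d.+1).
rewrite /chil /chi proper_star_hypergraph // -/(chid d adj) -/(chidl d adj).
(* For [r = d + 2] the term [r - 1] is [d + 1], so the size bound becomes [hcard]. *)
by apply; rewrite subn1 /= -addn2 -(addn1 d).
Qed.
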